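(* Let $\mathsf{M}$ be a theory with provability predicate $\Box$ and consistency sentence $\mathrm{Con}(\mathsf{M})$ as described in the context, and let $Y^G(k)$ be a formula of the language of $\mathsf{M}$ with the single free variable $k$ such that $$\mathsf{M}\vdash Y^G(k) \leftrightarrow (\forall x > k)\,[\neg\Box(\ulcorner Y^G(\dot{x})\urcorner)].$$ Then, with $k$ a free variable, $$\mathsf{M}\vdash \mathrm{Con}(\mathsf{M})\leftrightarrow Y^G(k).$$
   Context: $\mathsf{M}$ is a recursively enumerable first-order theory (classical logic) of reasonable power in the language of arithmetic, for instance Peano arithmetic $\mathsf{PA}$; ''reasonable power'' may be read as: $\mathsf{M}$ extends elementary arithmetic $I\Delta_0+\mathrm{exp}$. Notation. $\bar{n}$ is the numeral of the natural number $n$. $\ulcorner\phi\urcorner$ is the numeral of the Gödel number of $\phi$. With $x$ a variable, $\ulcorner\phi(\dot{x})\urcorner$ denotes the ($\mathsf{M}$-definable) function of $x$ whose value at $n$ is the Gödel number of the sentence $\phi(\bar{n})$ (similarly for several variables), so that $x$ is free in $\Box(\ulcorner\phi(\dot{x})\urcorner)$. $x\,\underline{\rightarrow}\,y$ denotes the arithmetized function taking Gödel numbers of two formulas to the Gödel number of the implication between them. $\Box$ is a standard provability predicate for $\mathsf{M}$: a $\Sigma_1$ formula with one free variable, true in the standard model of exactly the Gödel numbers of theorems of $\mathsf{M}$, and satisfying the generalized derivability conditions: (GD1) if $\mathsf{M}\vdash\phi(x)$ then $\mathsf{M}\vdash\Box(\ulcorner\phi(\dot{x})\urcorner)$; (GD2)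 $\mathsf{M}\vdash\Box(x\,\underline{\rightarrow}\,y)\rightarrow(\Box(x)\rightarrow\Box(y))$; (GD3) for every $\Sigma_1$ formula $\psi(y_1,\ldots,y_n)$, $\mathsf{M}\vdash\psi(y_1,\ldots,y_n)\rightarrow\Box(\ulcorner\psi(\dot{y}_1,\ldots,\dot{y}_n)\urcorner)$. $\mathrm{Con}(\mathsf{M})$ is the arithmetical consistency sentence $\neg\Box(\ulcorner 0=1\urcorner)$. A formula $Y^G$ as in the claim exists by the diagonal lemma with free variables. *)

(* Defs.v *)
From Stdlib Require Import List Arith Lia.
Import ListNotations.

(* Variables are de Bruijn indices. *)

Inductive tm : Type :=
| Var (i : nat)
| Zero
| Succ (t : tm)
| Add (s t : tm)
| Mul (s t : tm).

Inductive fm : Type :=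
| Fal
| Eq (s t : tm)
| Lt (s t : tm)
| Imp (p q : fm)
| And (p q : fm)
| Or (p q : fm)
| All (p : fm)
| Ex (p : fm).

Definition Neg (p : fm) : fm := Imp p Fal.
Definition Iff (p q : fm) : fm := And (Imp p q) (Imp q p).

Fixpoint num (n : nat) : tm :=
  match n with 0 => Zero | S n => Succ (num n) end.

Fixpoint subst_tm (f : nat -> tm) (t : tm) : tm :=
  match t with
  | Var i => f i
  | Zero => Zero
  | Succ t => Succ (subst_tm f t)
  | Add s t => Add (subst_tm f s) (subst_tm f t)
  | Mul s t => Mul (subst_tm f s) (subst_tm f t)
  end.

Definition scons {A : Type} (a : A) (f : nat -> A) (i : nat) : A :=
  match i with 0 => a | S i => f i end.

Definition shift_tm : tm -> tm := subst_tm (fun i => Var (S i)).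

Definition up (f : nat -> tm) : nat -> tm := scons (Var 0) (fun i => shift_tm (f i)).

Fixpoint subst (f : nat -> tm) (p : fm) : fm :=
  match p with
  | Fal => Fal
  | Eq s t => Eq (subst_tm f s) (subst_tm f t)
  | Lt s t => Lt (subst_tm f s) (subst_tm f t)
  | Imp p q => Imp (subst f p) (subst f q)
  | And p q => And (subst f p) (subst f q)
  | Or p q => Or (subst f p) (subst f q)
  | All p => All (subst (up f) p)
  | Ex p => Ex (subst (up f) p)
  end.

Definition shift : fm -> fm := subst (fun i => Var (S i)).

(* [inst p t] replaces variable 0 by [t] and lowers the other variables;
   [inst2 p s t] replaces variables 0 and 1 by [s] and [t]. *)
Definition inst (p : fm) (t : tm) : fm := subst (scons t Var) p.
Definition inst2 (p : fm) (s t : tm) : fm := subst (scons s (scons t Var)) p.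

(* [bounded n p]: all free variables of [p] are among 0, ..., n-1. *)
Fixpoint bounded_tm (n : nat) (t : tm) : Prop :=
  match t with
  | Var i => i < n
  | Zero => True
  | Succ t => bounded_tm n t
  | Add s t | Mul s t => bounded_tm n s /\ bounded_tm n t
  end.

Fixpoint bounded (n : nat) (p : fm) : Prop :=
  match p with
  | Fal => True
  | Eq s t | Lt s t => bounded_tm n s /\ bounded_tm n t
  | Imp p q | And p q | Or p q => bounded n p /\ bounded n q
  | All p | Ex p => bounded (S n) p
  end.

Fixpoint eval (v : nat -> nat) (t : tm) : nat :=
  match t with
  | Var i => v i
  | Zero => 0
  | Succ t => S (eval v t)
  | Add s t => eval v s + eval v t
  | Mul s t => eval v s * eval v t
  end.

Fixpoint sat (v : nat -> nat) (p : fm) : Prop :=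
  match p with
  | Fal => False
  | Eq s t => eval v s = eval v t
  | Lt s t => eval v s < eval v t
  | Imp p q => sat v p -> sat v q
  | And p q => sat v p /\ sat v q
  | Or p q => sat v p \/ sat v q
  | All p => forall n, sat (scons n v) p
  | Ex p => exists n, sat (scons n v) p
  end.

(* A theory is a set of axioms. Only the local hypotheses [G] are subject to
   the eigenvariable condition, so a free variable in an axiom is understood
   as universally quantified. *)

Definition theory : Type := fm -> Prop.

Inductive entails (T : theory) : list fm -> fm -> Prop :=
| AxI G p : T p -> entails T G p
| Hyp G p : In p G -> entails T G p
| ImpI G p q : entails T (p :: G) q -> entails T G (Imp p q)
| ImpE G p q : entails T G (Imp p q) -> entails T G p -> entails T G q
| Raa G p : entails T (Neg p :: G) Fal -> entails T G p
| AndI G p q : entails T G p -> entails T G q -> entails T G (And p q)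
| AndE1 G p q : entails T G (And p q) -> entails T G p
| AndE2 G p q : entails T G (And p q) -> entails T G q
| OrI1 G p q : entails T G p -> entails T G (Or p q)
| OrI2 G p q : entails T G q -> entails T G (Or p q)
| OrE G p q r : entails T G (Or p q) -> entails T (p :: G) r ->
    entails T (q :: G) r -> entails T G r
| AllI G p : entails T (map shift G) p -> entails T G (All p)
| AllE G p t : entails T G (All p) -> entails T G (inst p t)
| ExI G p t : entails T G (inst p t) -> entails T G (Ex p)
| ExE G p q : entails T G (Ex p) -> entails T (p :: map shift G) (shift q) ->
    entails T G q
| EqRefl G t : entails T G (Eq t t)
| EqSub G p s t : entails T G (Eq s t) -> entails T G (inst p s) ->
    entails T G (inst p t).

Definition proves (T : theory) (p : fm) : Prop := entails T [] p.

Notation "T ⊢ p" := (proves T p) (at level 70, no associativity).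

Inductive Delta0 : fm -> Prop :=
| D0_Fal : Delta0 Fal
| D0_Eq s t : Delta0 (Eq s t)
| D0_Lt s t : Delta0 (Lt s t)
| D0_Imp p q : Delta0 p -> Delta0 q -> Delta0 (Imp p q)
| D0_And p q : Delta0 p -> Delta0 q -> Delta0 (And p q)
| D0_Or p q : Delta0 p -> Delta0 q -> Delta0 (Or p q)
| D0_All t p : Delta0 p -> Delta0 (All (Imp (Lt (Var 0) (shift_tm t)) p))
| D0_Ex t p : Delta0 p -> Delta0 (Ex (And (Lt (Var 0) (shift_tm t)) p)).

Inductive Sigma1 : fm -> Prop :=
| S1_D0 p : Delta0 p -> Sigma1 p
| S1_Ex p : Sigma1 p -> Sigma1 (Ex p).

Inductive IDelta0 : theory :=
| Q_succ_zero : IDelta0 (Neg (Eq (Succ (Var 0)) Zero))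
| Q_succ_inj : IDelta0 (Imp (Eq (Succ (Var 0)) (Succ (Var 1))) (Eq (Var 0) (Var 1)))
| Q_cases : IDelta0 (Or (Eq (Var 0) Zero) (Ex (Eq (Var 1) (Succ (Var 0)))))
| Q_add_zero : IDelta0 (Eq (Add (Var 0) Zero) (Var 0))
| Q_add_succ : IDelta0 (Eq (Add (Var 0) (Succ (Var 1))) (Succ (Add (Var 0) (Var 1))))
| Q_mul_zero : IDelta0 (Eq (Mul (Var 0) Zero) Zero)
| Q_mul_succ : IDelta0 (Eq (Mul (Var 0) (Succ (Var 1))) (Add (Mul (Var 0) (Var 1)) (Var 0)))
| Q_lt : IDelta0 (Iff (Lt (Var 0) (Var 1))
                      (Ex (Eq (Add (Succ (Var 0)) (Var 1)) (Var 2))))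
| Ind p : Delta0 p ->
    IDelta0 (Imp (inst p Zero)
              (Imp (All (Imp p (subst (scons (Succ (Var 0)) (fun i => Var (S i))) p)))
                   (All p))).

(* [E] is a Delta_0 formula for the graph 2^(variable 0) = variable 1 whose
   recursion equations are provable in IDelta_0. By Delta_0-induction any two
   such formulas are provably equivalent in IDelta_0, so the theory
   [IDelta0_exp E] does not depend on the choice of [E]. *)
Record exp_graph (E : fm) : Prop := {
  exp_Delta0 : Delta0 E;
  exp_bounded : bounded 2 E;
  exp_zero : IDelta0 ⊢ Iff (inst2 E Zero (Var 0)) (Eq (Var 0) (num 1));
  exp_succ : IDelta0 ⊢
    Iff (inst2 E (Succ (Var 0)) (Var 1))
        (Ex (And (inst2 E (Var 1) (Var 0)) (Eq (Var 2) (Add (Var 0) (Var 0)))))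
}.

Inductive IDelta0_exp (E : fm) : theory :=
| exp_base p : IDelta0 p -> IDelta0_exp E p
| exp_total : IDelta0_exp E (All (Ex (inst2 E (Var 1) (Var 0)))).

Definition extends_elementary_arithmetic (M : theory) : Prop :=
  exists E, exp_graph E /\ forall p, IDelta0_exp E p -> M ⊢ p.

(* In [MRec f g], the step function [g] receives the counter, then the previous
   value, then the parameters; [MMin f] minimizes over the first argument of [f]. *)

Inductive mu : Type :=
| MZero
| MSucc
| MProj (i : nat)
| MComp (f : mu) (gs : list mu)
| MRec (f g : mu)
| MMin (f : mu).

Inductive computes : mu -> list nat -> nat -> Prop :=
| c_zero v : computes MZero v 0
| c_succ x v : computes MSucc (x :: v) (S x)
| c_proj i v x : nth_error v i = Some x -> computes (MProj i) v x
| c_comp f gs v ys z : Forall2 (fun g y => computes g v y) gs ys ->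
    computes f ys z -> computes (MComp f gs) v z
| c_rec_zero f g v z : computes f v z -> computes (MRec f g) (0 :: v) z
| c_rec_succ f g n v y z : computes (MRec f g) (n :: v) y ->
    computes g (n :: y :: v) z -> computes (MRec f g) (S n :: v) z
| c_min f n v : computes f (n :: v) 0 ->
    (forall m, m < n -> exists k, computes f (m :: v) (S k)) ->
    computes (MMin f) v n.

Definition recursively_enumerable (A : nat -> Prop) : Prop :=
  exists f, forall n, A n <-> exists m, computes f [n] m.

(* The Gödel numbering is built from the injective polynomial pairing
   <a,b> = (a+b)^2 + a. A maximal block of successors is coded by its length:
   a term S...S u with n leading successors, where u does not start with a
   successor, has Gödel number <n, core u>. Hence the Gödel number of the
   numeral of n, and for fixed p that of p(n), is polynomial in n, so that the
   dotted quotation [dot p] below is given by a term of the language of arithmetic. *)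

Definition pair (a b : nat) : nat := (a + b) * (a + b) + a.

Fixpoint succs (t : tm) : nat :=
  match t with Succ t => S (succs t) | _ => 0 end.

Fixpoint core (t : tm) : nat :=
  match t with
  | Var i => pair 1 i
  | Zero => pair 0 0
  | Succ t => core t
  | Add s t => pair 2 (pair (pair (succs s) (core s)) (pair (succs t) (core t)))
  | Mul s t => pair 3 (pair (pair (succs s) (core s)) (pair (succs t) (core t)))
  end.

Definition gn_tm (t : tm) : nat := pair (succs t) (core t).

Fixpoint gn (p : fm) : nat :=
  match p with
  | Fal => pair 0 0
  | Eq s t => pair 1 (pair (gn_tm s) (gn_tm t))
  | Lt s t => pair 2 (pair (gn_tm s) (gn_tm t))
  | Imp p q => pair 3 (pair (gn p) (gn q))
  | And p q => pair 4 (pair (gn p) (gn q))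
  | Or p q => pair 5 (pair (gn p) (gn q))
  | All p => pair 6 (gn p)
  | Ex p => pair 7 (gn p)
  end.

Definition quote (p : fm) : tm := num (gn p).

Definition pair_t (s t : tm) : tm := Add (Mul (Add s t) (Add s t)) s.

(* [imp_t x y] is the arithmetized implication x _->_ y. *)
Definition imp_t (x y : tm) : tm := pair_t (num 3) (pair_t x y).

(* [dot p] is the term, in the free variables of [p], whose value at a tuple of
   numbers is the Gödel number of [p] with the corresponding numerals
   substituted for the variables (see [eval_dot]). The index [d] is the number
   of binders passed, so variables below [d] are bound and are coded as such. *)
Fixpoint dot_succs (d : nat) (t : tm) : tm :=
  match t with
  | Var i => if i <? d then Zero else Var (i - d)
  | Succ t => Succ (dot_succs d t)
  | _ => Zero
  end.

Fixpoint dot_core (d : nat) (t : tm) : tm :=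
  match t with
  | Var i => if i <? d then num (pair 1 i) else num (pair 0 0)
  | Zero => num (pair 0 0)
  | Succ t => dot_core d t
  | Add s t => pair_t (num 2) (pair_t (pair_t (dot_succs d s) (dot_core d s))
                                      (pair_t (dot_succs d t) (dot_core d t)))
  | Mul s t => pair_t (num 3) (pair_t (pair_t (dot_succs d s) (dot_core d s))
                                      (pair_t (dot_succs d t) (dot_core d t)))
  end.

Definition dot_tm (d : nat) (t : tm) : tm := pair_t (dot_succs d t) (dot_core d t).

Fixpoint dot_fm (d : nat) (p : fm) : tm :=
  match p with
  | Fal => num (pair 0 0)
  | Eq s t => pair_t (num 1) (pair_t (dot_tm d s) (dot_tm d t))
  | Lt s t => pair_t (num 2) (pair_t (dot_tm d s) (dot_tm d t))
  | Imp p q => imp_t (dot_fm d p) (dot_fm d q)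
  | And p q => pair_t (num 4) (pair_t (dot_fm d p) (dot_fm d q))
  | Or p q => pair_t (num 5) (pair_t (dot_fm d p) (dot_fm d q))
  | All p => pair_t (num 6) (dot_fm (S d) p)
  | Ex p => pair_t (num 7) (dot_fm (S d) p)
  end.

Definition dot (p : fm) : tm := dot_fm 0 p.

Lemma pair_inj a b c d : pair a b = pair c d -> a = c /\ b = d.
Proof. unfold pair; intros H. assert (a + b = c + d) by nia. nia. Qed.

Lemma gn_tm_inj s t : gn_tm s = gn_tm t -> s = t.
Proof.
  unfold gn_tm; revert t; induction s; intros t H; apply pair_inj in H as [H1 H2];
    destruct t; cbn -[pair] in *; try discriminate;
    try (apply pair_inj in H2 as [H2 H3]; try discriminate).
  - now subst.
  - reflexivity.
  - f_equal; apply IHs; congruence.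
  - apply pair_inj in H3 as [H3 H4]; f_equal; auto.
  - apply pair_inj in H3 as [H3 H4]; f_equal; auto.
Qed.

Lemma gn_inj p q : gn p = gn q -> p = q.
Proof.
  revert q; induction p; intros [] H; cbn -[pair] in H; apply pair_inj in H as [H1 H2];
    try discriminate; try (apply pair_inj in H2 as [H2 H3]);
    f_equal; auto using gn_tm_inj.
Qed.

Lemma eval_num v n : eval v (num n) = n.
Proof. induction n; cbn; congruence. Qed.

Lemma subst_num f n : subst_tm f (num n) = num n.
Proof. induction n as [|n IH]; cbn; [reflexivity|now rewrite IH]. Qed.

Lemma eval_pair_t v s t : eval v (pair_t s t) = pair (eval v s) (eval v t).
Proof. reflexivity. Qed.

Lemma eval_imp_t v p q : eval v (imp_t (quote p) (quote q)) = gn (Imp p q).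
Proof. unfold imp_t; now rewrite !eval_pair_t; unfold quote; rewrite !eval_num. Qed.

Fixpoint upn (d : nat) (f : nat -> tm) : nat -> tm :=
  match d with 0 => f | S d => up (upn d f) end.

Lemma upn_num d v i :
  upn d (fun j => num (v j)) i = if i <? d then Var i else num (v (i - d)).
Proof.
  revert i; induction d as [|d IH]; intros i; cbn -[Nat.ltb].
  - now rewrite Nat.sub_0_r.
  - destruct i as [|i]; [reflexivity|].
    unfold up, scons, shift_tm; rewrite IH.
    change (S i <? S d) with (i <? d).
    destruct (i <? d); [reflexivity|now rewrite subst_num].
Qed.

Lemma succs_num n : succs (num n) = n.
Proof. induction n; cbn; congruence. Qed.

Lemma core_num n : core (num n) = pair 0 0.
Proof. induction n as [|n IH]; [reflexivity|exact IH]. Qed.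

Lemma eval_dot_tm d v t :
  eval v (dot_succs d t) = succs (subst_tm (upn d (fun i => num (v i))) t) /\
  eval v (dot_core d t) = core (subst_tm (upn d (fun i => num (v i))) t).
Proof.
  induction t as [i| |t [IH1 IH2]|s [IH1 IH2] t [IH3 IH4]|s [IH1 IH2] t [IH3 IH4]];
    cbn -[pair pair_t Nat.ltb num].
  - rewrite upn_num; destruct (i <? d); cbn -[pair];
      now rewrite ?eval_num, ?succs_num, ?core_num.
  - now rewrite eval_num.
  - now rewrite IH1, IH2.
  - split; [reflexivity|]. now rewrite !eval_pair_t, !eval_num, IH1, IH2, IH3, IH4.
  - split; [reflexivity|]. now rewrite !eval_pair_t, !eval_num, IH1, IH2, IH3, IH4.
Qed.

Lemma eval_dot_fm d v p :
  eval v (dot_fm d p) = gn (subst (upn d (fun i => num (v i))) p).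
Proof.
  revert d; induction p; intros d; cbn -[pair pair_t num];
    unfold imp_t, dot_tm, gn_tm; rewrite ?eval_pair_t, ?eval_num;
    repeat match goal with
    | |- context [eval v (dot_succs d ?t)] =>
        rewrite (proj1 (eval_dot_tm d v t)), (proj2 (eval_dot_tm d v t))
    end;
    rewrite ?IHp, ?IHp1, ?IHp2; reflexivity.
Qed.

Theorem eval_dot v p : eval v (dot p) = gn (subst (fun i => num (v i)) p).
Proof. exact (eval_dot_fm 0 v p). Qed.

Definition theorem_number (M : theory) (n : nat) : Prop :=
  exists p, M ⊢ p /\ n = gn p.

(* Theorems may have free variables, here and in [theorem_number]. [GD3] is for
   any number of variables: [dot p] dots all the free variables of [p]. *)
Record provability_predicate (M : theory) (Box : fm) : Prop := {
  box_Sigma1 : Sigma1 Box;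
  box_bounded : bounded 1 Box;
  box_standard : forall n v, sat (scons n v) Box <-> theorem_number M n;
  GD1 : forall p, bounded 1 p -> M ⊢ p -> M ⊢ inst Box (dot p);
  GD2 : M ⊢ Imp (inst Box (imp_t (Var 0) (Var 1)))
                (Imp (inst Box (Var 0)) (inst Box (Var 1)));
  GD3 : forall p, Sigma1 p -> M ⊢ Imp p (inst Box (dot p))
}.

Definition Con (Box : fm) : fm := Neg (inst Box (quote (Eq (num 0) (num 1)))).

(* Main.v *)
From Stdlib Require Import List Arith Lia.
Require Import Defs.
Import ListNotations.

(** The fixed point makes each Y(k) say that no Y(x) with x > k is provable: a
    Yablo sequence, in which every sentence denies all the later ones.

    Inconsistency refutes Y(k): if 0 = 1 is provable then everything is, in
    particular Y(k+1), and k+1 > k ([Y_Con]).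

    Conversely let Y(k) fail, so that Y(x) is provable for some x > k. The theory
    knows that Y(x) implies Y(x+1), since a number above x+1 is above x ([Y_Succ]),
    and that Y(x) implies the unprovability of Y(x+1), since x+1 is above x
    ([Y_Succ_not_Box]). Reasoning inside the box, Y(x+1) is provable, and it is
    provable that Y(x+1) is not provable. The first of these facts is Sigma_1, hence
    itself provable, and so 0 = 1 is provable ([Box_Y_inconsistent], [Con_Y]).

    All this takes place inside the theory, with x a free variable, so a number of
    formal points carry weight. Derivability of a formula gives derivability of its
    substitution instances ([proves_subst]), although axioms may have free variables.
    Dotted quotation commutes with the substitution of x+1 for x ([dot_subst]), so
    that the box of the formula Y(x+1) is the box of Y at x+1. Closed terms provably
    have the values that they have ([closed_term_value]), so that the dotted quotation
    of the sentence 0 = 1 may be exchanged for the numeral in the consistency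
    sentence ([Box_dot_quote]). The order facts used about the successor come from
    two small inductions ([Zero_Add], [Succ_Add]), because the axiom for Lt puts the
    difference to the left in the sum whereas the recursion is on the right summand. *)

(** * Substitution and free variables *)

Lemma subst_tm_ext_bounded n f g t :
  bounded_tm n t -> (forall i, i < n -> f i = g i) -> subst_tm f t = subst_tm g t.
Proof.
  intros Ht Hfg; induction t; cbn in *; try destruct Ht; f_equal; auto.
Qed.

Lemma subst_ext_bounded n f g p :
  bounded n p -> (forall i, i < n -> f i = g i) -> subst f p = subst g p.
Proof.
  revert n f g; induction p; intros n f g Hp Hfg; cbn in *; try destruct Hp;
    f_equal; eauto using subst_tm_ext_bounded.
  all: apply (IHp (S n)); [assumption|].
  all: intros [|i] Hi; cbn; [reflexivity|rewrite Hfg by lia; reflexivity].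
Qed.

Lemma bounded_tm_mono m n t : bounded_tm m t -> m <= n -> bounded_tm n t.
Proof. intros Ht Hmn; induction t; cbn in *; intuition lia. Qed.

Lemma bounded_mono m n p : bounded m p -> m <= n -> bounded n p.
Proof.
  revert m n; induction p; intros m n Hp Hmn; cbn in *; try destruct Hp;
    try split; eauto using bounded_tm_mono.
  all: apply (IHp (S m)); [assumption|lia].
Qed.

Lemma bounded_tm_ex t : exists n, bounded_tm n t.
Proof.
  induction t as [i| |t [n Hn]|s [m Hm] t [n Hn]|s [m Hm] t [n Hn]]; cbn.
  - exists (S i); lia.
  - now exists 0.
  - now exists n.
  - exists (max m n); split; eapply bounded_tm_mono; eauto; lia.
  - exists (max m n); split; eapply bounded_tm_mono; eauto; lia.
Qed.

Lemma bounded_ex p : exists n, bounded n p.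
Proof.
  induction p as [|s t|s t|p [m Hm] q [n Hn]|p [m Hm] q [n Hn]|p [m Hm] q [n Hn]
                 |p [n Hn]|p [n Hn]]; cbn.
  - now exists 0.
  - destruct (bounded_tm_ex s) as [m Hm], (bounded_tm_ex t) as [n Hn].
    exists (max m n); split; eapply bounded_tm_mono; eauto; lia.
  - destruct (bounded_tm_ex s) as [m Hm], (bounded_tm_ex t) as [n Hn].
    exists (max m n); split; eapply bounded_tm_mono; eauto; lia.
  - exists (max m n); split; eapply bounded_mono; eauto; lia.
  - exists (max m n); split; eapply bounded_mono; eauto; lia.
  - exists (max m n); split; eapply bounded_mono; eauto; lia.
  - exists n; apply (bounded_mono n); auto.
  - exists n; apply (bounded_mono n); auto.
Qed.

Lemma subst_tm_ext f g t : (forall i, f i = g i) -> subst_tm f t = subst_tm g t.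
Proof. destruct (bounded_tm_ex t); eauto using subst_tm_ext_bounded. Qed.

Lemma subst_ext f g p : (forall i, f i = g i) -> subst f p = subst g p.
Proof. destruct (bounded_ex p); eauto using subst_ext_bounded. Qed.

Lemma subst_tm_id t : subst_tm Var t = t.
Proof. induction t; cbn; congruence. Qed.

Lemma subst_id p : subst Var p = p.
Proof.
  induction p; cbn; rewrite ?subst_tm_id; f_equal; auto.
  all: rewrite <- IHp at 2; apply subst_ext; now intros [|i].
Qed.

Lemma subst_bounded_id n f p :
  bounded n p -> (forall i, i < n -> f i = Var i) -> subst f p = p.
Proof. intros Hp Hf; rewrite <- (subst_id p) at 2; eauto using subst_ext_bounded. Qed.

Lemma subst_tm_comp f g t :
  subst_tm g (subst_tm f t) = subst_tm (fun i => subst_tm g (f i)) t.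
Proof. induction t; cbn; congruence. Qed.

Lemma up_comp f g i : subst_tm (up g) (up f i) = up (fun i => subst_tm g (f i)) i.
Proof. destruct i; cbn; [reflexivity|]. unfold shift_tm; now rewrite !subst_tm_comp. Qed.

Lemma subst_comp f g p : subst g (subst f p) = subst (fun i => subst_tm g (f i)) p.
Proof.
  revert f g; induction p; intros f g; cbn; rewrite ?subst_tm_comp; f_equal; auto.
  all: rewrite IHp; apply subst_ext, up_comp.
Qed.

Lemma subst_shift_tm f t : subst_tm f (shift_tm t) = subst_tm (fun i => f (S i)) t.
Proof. apply subst_tm_comp. Qed.

Lemma inst_shift_tm s t : subst_tm (scons s Var) (shift_tm t) = t.
Proof. rewrite subst_shift_tm; apply subst_tm_id. Qed.

Lemma subst_up_shift_tm f t : subst_tm (up f) (shift_tm t) = shift_tm (subst_tm f t).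
Proof. rewrite subst_shift_tm; symmetry; apply subst_tm_comp. Qed.

(** With one free variable, instances are stable under substitution into the term;
    this is what makes [Box] and [Y] usable as predicates of terms. *)
Lemma subst_inst p t f : bounded 1 p -> subst f (inst p t) = inst p (subst_tm f t).
Proof.
  intros Hp; unfold inst; rewrite subst_comp.
  apply (subst_ext_bounded 1); [assumption|]. intros [|i] Hi; [reflexivity|lia].
Qed.

Lemma shift_inst p t : bounded 1 p -> shift (inst p t) = inst p (shift_tm t).
Proof. apply subst_inst. Qed.

Lemma inst_Var0 p : bounded 1 p -> inst p (Var 0) = p.
Proof.
  intros Hp; apply (subst_bounded_id 1); [assumption|].
  intros [|i] Hi; [reflexivity|lia].
Qed.

Lemma bounded_subst_tm m n f t :
  bounded_tm n t -> (forall i, i < n -> bounded_tm m (f i)) ->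
  bounded_tm m (subst_tm f t).
Proof. intros Ht Hf; induction t; cbn in *; intuition. Qed.

Lemma bounded_subst m n f p :
  bounded n p -> (forall i, i < n -> bounded_tm m (f i)) -> bounded m (subst f p).
Proof.
  revert m n f; induction p; intros m n f Hp Hf; cbn in *; try destruct Hp;
    try split; eauto using bounded_subst_tm.
  all: apply (IHp (S m) (S n)); [assumption|].
  all: intros [|i] Hi; cbn; [lia|].
  all: apply (bounded_subst_tm _ m); [apply Hf; lia|intros; cbn; lia].
Qed.

Lemma bounded_inst n p t : bounded 1 p -> bounded_tm n t -> bounded n (inst p t).
Proof.
  intros Hp Ht; apply (bounded_subst _ 1); [assumption|].
  intros [|i] Hi; [exact Ht|lia].
Qed.

Lemma bounded_num n k : bounded_tm n (num k).
Proof. induction k; cbn; auto. Qed.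

Lemma Delta0_subst f p : Delta0 p -> Delta0 (subst f p).
Proof.
  intros Hp; revert f; induction Hp; intros f; cbn; rewrite ?subst_up_shift_tm;
    constructor; auto.
Qed.

Lemma Sigma1_subst f p : Sigma1 p -> Sigma1 (subst f p).
Proof.
  intros Hp; revert f; induction Hp; intros f; cbn;
    [apply S1_D0, Delta0_subst|apply S1_Ex]; auto.
Qed.

(** * Derived rules *)

Lemma entails_weaken T G G' p : entails T G p -> incl G G' -> entails T G' p.
Proof.
  intros H; revert G'; induction H; intros G' HG;
    try solve [econstructor; eauto using incl_refl, incl_map].
  - apply ImpI, IHentails. apply incl_cons; [now left|now apply incl_tl].
  - apply Raa, IHentails. apply incl_cons; [now left|now apply incl_tl].
  - apply OrE with p q; auto.
    + apply IHentails2, incl_cons; [now left|now apply incl_tl].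
    + apply IHentails3, incl_cons; [now left|now apply incl_tl].
  - apply ExE with p; auto.
    apply IHentails2, incl_cons; [now left|]. now apply incl_tl, incl_map.
Qed.

Lemma entails_of_proves T G p : T ⊢ p -> entails T G p.
Proof. intros H; apply (entails_weaken _ _ _ _ H); intros q []. Qed.

Lemma AllE_subst T G f p t :
  entails T G (subst f (All p)) -> entails T G (subst (scons t f) p).
Proof.
  intros H; apply (AllE _ _ _ t) in H; unfold inst in H; rewrite subst_comp in H.
  erewrite subst_ext; [exact H|].
  intros [|i]; cbn; [reflexivity|now rewrite inst_shift_tm].
Qed.

(** Axioms may have free variables, so this is not an induction on derivations:
    the variables are generalized one by one and then instantiated again. *)
Lemma proves_subst T G f p : T ⊢ p -> entails T G (subst f p).
Proof.
  intros H; destruct (bounded_ex p) as [n Hn]; revert f p H Hn.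
  induction n as [|n IH]; intros f p H Hn.
  - rewrite (subst_bounded_id 0); [now apply entails_of_proves|assumption|lia].
  - assert (HA : entails T G (subst (fun i => f (S i)) (All p))).
    { apply IH; [apply AllI; exact H|exact Hn]. }
    apply (AllE_subst _ _ _ _ (f 0)) in HA.
    erewrite subst_ext; [exact HA|now intros [|i]].
Qed.

Lemma proves_All_subst T G f p : T ⊢ All p -> entails T G (subst f p).
Proof.
  intros H. pose proof (proves_subst T G (fun i => f (S i)) _ H) as HA.
  apply (AllE_subst _ _ _ _ (f 0)) in HA.
  erewrite subst_ext; [exact HA|now intros [|i]].
Qed.

Lemma Imp_mp T G p q : T ⊢ Imp p q -> entails T G p -> entails T G q.
Proof. intros H; apply ImpE, entails_of_proves, H. Qed.

Section Equality.
Context (T : theory) (G : list fm).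

Lemma Eq_sym s t : entails T G (Eq s t) -> entails T G (Eq t s).
Proof.
  intros H; apply (EqSub _ _ (Eq (Var 0) (shift_tm s))) in H; unfold inst in *;
    cbn in *; rewrite inst_shift_tm in *; [exact H|apply EqRefl].
Qed.

Lemma Eq_trans s t u :
  entails T G (Eq s t) -> entails T G (Eq t u) -> entails T G (Eq s u).
Proof.
  intros H1 H2; apply (EqSub _ _ (Eq (shift_tm s) (Var 0))) in H2; unfold inst in *;
    cbn in *; rewrite inst_shift_tm in *; assumption.
Qed.

(** Congruence for all function symbols at once: [u] is a context with its hole at
   variable 0, and [EqSub] rewrites the right-hand copy of a reflexivity. *)
Lemma Eq_congr s t u :
  entails T G (Eq s t) ->
  entails T G (Eq (subst_tm (scons s Var) u) (subst_tm (scons t Var) u)).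
Proof.
  intros H; apply (EqSub _ _ (Eq (shift_tm (subst_tm (scons s Var) u)) u)) in H;
    unfold inst in *; cbn in *; rewrite inst_shift_tm in *; [exact H|apply EqRefl].
Qed.

Lemma Eq_Succ s t : entails T G (Eq s t) -> entails T G (Eq (Succ s) (Succ t)).
Proof. exact (Eq_congr s t (Succ (Var 0))). Qed.

Lemma Eq_Add s s' t t' :
  entails T G (Eq s s') -> entails T G (Eq t t') ->
  entails T G (Eq (Add s t) (Add s' t')).
Proof.
  intros H1%(Eq_congr _ _ (Add (Var 0) (shift_tm t)))
         H2%(Eq_congr _ _ (Add (shift_tm s') (Var 0))).
  cbn in *; rewrite !inst_shift_tm in *; eauto using Eq_trans.
Qed.

Lemma Eq_Mul s s' t t' :
  entails T G (Eq s s') -> entails T G (Eq t t') ->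
  entails T G (Eq (Mul s t) (Mul s' t')).
Proof.
  intros H1%(Eq_congr _ _ (Mul (Var 0) (shift_tm t)))
         H2%(Eq_congr _ _ (Mul (shift_tm s') (Var 0))).
  cbn in *; rewrite !inst_shift_tm in *; eauto using Eq_trans.
Qed.

End Equality.

(** * Arithmetic *)

Section Arithmetic.
Context (T : theory) (T_IDelta0 : forall p, IDelta0 p -> T ⊢ p).

Lemma axiom_subst G f p : IDelta0 p -> entails T G (subst f p).
Proof. intros H; apply proves_subst, T_IDelta0, H. Qed.

Lemma Add_Zero G t : entails T G (Eq (Add t Zero) t).
Proof. exact (axiom_subst G (scons t Var) _ Q_add_zero). Qed.

Lemma Add_Succ G s t : entails T G (Eq (Add s (Succ t)) (Succ (Add s t))).
Proof. exact (axiom_subst G (scons s (scons t Var)) _ Q_add_succ). Qed.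

Lemma Mul_Zero G t : entails T G (Eq (Mul t Zero) Zero).
Proof. exact (axiom_subst G (scons t Var) _ Q_mul_zero). Qed.

Lemma Mul_Succ G s t : entails T G (Eq (Mul s (Succ t)) (Add (Mul s t) s)).
Proof. exact (axiom_subst G (scons s (scons t Var)) _ Q_mul_succ). Qed.

Lemma zero_ne_one G : entails T G (Neg (Eq (num 0) (num 1))).
Proof.
  apply ImpI, ImpE with (Eq (num 1) (num 0)).
  - exact (axiom_subst _ (scons Zero Var) _ Q_succ_zero).
  - apply Eq_sym, Hyp; now left.
Qed.

Lemma proves_induction p :
  Delta0 p -> T ⊢ inst p Zero ->
  entails T [p] (subst (scons (Succ (Var 0)) (fun i => Var (S i))) p) -> T ⊢ All p.
Proof.
  intros Hp H0 HS.
  refine (ImpE _ _ _ _ (ImpE _ _ _ _ (T_IDelta0 _ (Ind p Hp)) H0) _).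
  apply AllI, ImpI, HS.
Qed.

Lemma Zero_Add G t : entails T G (Eq (Add Zero t) t).
Proof.
  refine (proves_All_subst T G (scons t Var) (Eq (Add Zero (Var 0)) (Var 0)) _).
  apply proves_induction; [constructor|apply Add_Zero|].
  cbn. eapply Eq_trans; [apply Add_Succ|]. apply Eq_Succ, Hyp; now left.
Qed.

Lemma Succ_Add G s t : entails T G (Eq (Add (Succ s) t) (Succ (Add s t))).
Proof.
  refine (proves_All_subst T G (scons t (scons s Var))
    (Eq (Add (Succ (Var 1)) (Var 0)) (Succ (Add (Var 1) (Var 0)))) _).
  apply proves_induction; [constructor| |]; cbn.
  - eapply Eq_trans; [apply Add_Zero|]. apply Eq_Succ, Eq_sym, Add_Zero.
  - eapply Eq_trans; [apply Add_Succ|]. apply Eq_Succ.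
    eapply Eq_trans; [apply Hyp; now left|]. apply Eq_sym, Add_Succ.
Qed.

Lemma Lt_def G s t :
  entails T G (Iff (Lt s t) (Ex (Eq (Add (Succ (Var 0)) (shift_tm s)) (shift_tm t)))).
Proof. exact (axiom_subst G (scons s (scons t Var)) _ Q_lt). Qed.

Lemma Lt_intro G s t u : entails T G (Eq (Add (Succ u) s) t) -> entails T G (Lt s t).
Proof.
  intros H; eapply ImpE; [eapply AndE2, Lt_def|].
  apply ExI with u; unfold inst; cbn; now rewrite !inst_shift_tm.
Qed.

Lemma Lt_Succ G t : entails T G (Lt t (Succ t)).
Proof.
  apply Lt_intro with Zero. eapply Eq_trans; [apply Succ_Add|].
  apply Eq_Succ, Zero_Add.
Qed.

Lemma Lt_of_Succ_Lt G s t : entails T G (Lt (Succ s) t) -> entails T G (Lt s t).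
Proof.
  intros H; eapply ExE.
  - eapply ImpE; [eapply AndE1, Lt_def|exact H].
  (* The difference between t and s exceeds that between t and s+1 by one. *)
  - apply Lt_intro with (Succ (Var 0)).
    eapply Eq_trans; [apply Succ_Add|].
    eapply Eq_trans; [apply Eq_sym, Add_Succ|].
    apply Hyp; now left.
Qed.

Lemma Add_num G m n : entails T G (Eq (Add (num m) (num n)) (num (m + n))).
Proof.
  induction n as [|n IH]; cbn.
  - rewrite Nat.add_0_r; apply Add_Zero.
  - rewrite Nat.add_succ_r. eapply Eq_trans; [apply Add_Succ|]. apply Eq_Succ, IH.
Qed.

Lemma Mul_num G m n : entails T G (Eq (Mul (num m) (num n)) (num (m * n))).
Proof.
  induction n as [|n IH]; cbn.
  - rewrite Nat.mul_0_r; apply Mul_Zero.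
  - rewrite Nat.mul_succ_r. eapply Eq_trans; [apply Mul_Succ|].
    eapply Eq_trans; [apply Eq_Add; [exact IH|apply EqRefl]|]. apply Add_num.
Qed.

Lemma closed_term_value G v t :
  bounded_tm 0 t -> entails T G (Eq t (num (eval v t))).
Proof.
  intros Ht; induction t; cbn in *.
  - lia.
  - apply EqRefl.
  - apply Eq_Succ; auto.
  - destruct Ht. eapply Eq_trans; [apply Eq_Add; auto|apply Add_num].
  - destruct Ht. eapply Eq_trans; [apply Eq_Mul; auto|apply Mul_num].
Qed.

End Arithmetic.

(** * Dotted quotation *)

Lemma bounded_pair_t n s t : bounded_tm n s -> bounded_tm n t -> bounded_tm n (pair_t s t).
Proof. cbn; auto. Qed.

Lemma bounded_dot_tm n d t :
  bounded_tm (d + n) t -> bounded_tm n (dot_succs d t) /\ bounded_tm n (dot_core d t).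
Proof.
  induction t; cbn -[pair pair_t num Nat.ltb]; intros H;
    repeat match goal with
    | H : _ /\ _ |- _ => destruct H
    | IH : ?P -> _, H : ?P |- _ => specialize (IH H)
    end; split; auto using bounded_pair_t, bounded_num.
  - destruct (Nat.ltb_spec i d); cbn; [exact I|lia].
  - destruct (i <? d); apply bounded_num.
Qed.

Lemma bounded_dot_fm n d p : bounded (d + n) p -> bounded_tm n (dot_fm d p).
Proof.
  revert d; induction p; intros d; cbn -[pair pair_t num]; intros H; unfold imp_t, dot_tm;
    try match type of H with _ /\ _ => destruct H as [H1 H2] end;
    try destruct (bounded_dot_tm n d _ H1), (bounded_dot_tm n d _ H2);
    auto 7 using bounded_pair_t, bounded_num.
Qed.

Lemma bounded_dot n p : bounded n p -> bounded_tm n (dot p).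
Proof. apply (bounded_dot_fm n 0). Qed.

(** The terms that [dot] codes as the numeral of their value, for every value of the
    variables: a block of successors is coded by its length, and a variable below
    the block contributes its own value to that length. *)
Fixpoint succ_atom (t : tm) : Prop :=
  match t with
  | Var _ | Zero => True
  | Succ t => succ_atom t
  | _ => False
  end.

(** Written with one shift by [d] rather than [d] successive shifts, so that the
    result visibly avoids the [d] bound variables. *)
Lemma upn_ge d f i :
  d <= i -> upn d f i = subst_tm (fun j => Var (j + d)) (f (i - d)).
Proof.
  revert i; induction d as [|d IH]; intros i Hi; cbn.
  - rewrite Nat.sub_0_r. rewrite <- (subst_tm_id (f i)) at 1.
    apply subst_tm_ext; intros j; now rewrite Nat.add_0_r.
  - destruct i as [|i]; [lia|]; cbn. rewrite IH by lia.
    unfold shift_tm; rewrite subst_tm_comp; cbn.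
    apply subst_tm_ext; intros j; now rewrite Nat.add_succ_r.
Qed.

Lemma upn_lt d f i : i < d -> upn d f i = Var i.
Proof.
  revert i; induction d as [|d IH]; intros i Hi; [lia|].
  destruct i as [|i]; cbn; [reflexivity|]. now rewrite IH by lia.
Qed.

Lemma dot_succ_atom d t :
  succ_atom t ->
  dot_succs d (subst_tm (fun j => Var (j + d)) t) = t /\
  dot_core d (subst_tm (fun j => Var (j + d)) t) = num (pair 0 0).
Proof.
  induction t; cbn -[Nat.ltb]; intros H; try tauto.
  - destruct (Nat.ltb_spec (i + d) d); [lia|].
    split; [f_equal; lia|reflexivity].
  - destruct (IHt H) as [H1 H2]; now rewrite H1, H2.
Qed.

Lemma subst_pair_t f s t : subst_tm f (pair_t s t) = pair_t (subst_tm f s) (subst_tm f t).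
Proof. reflexivity. Qed.

Section DotSubst.
Context (f : nat -> tm) (f_succ_atom : forall i, succ_atom (f i)).

Lemma dot_tm_subst d t :
  dot_succs d (subst_tm (upn d f) t) = subst_tm f (dot_succs d t) /\
  dot_core d (subst_tm (upn d f) t) = subst_tm f (dot_core d t).
Proof.
  induction t as [i| |t [IH1 IH2]|s [IH1 IH2] t [IH3 IH4]|s [IH1 IH2] t [IH3 IH4]];
    cbn -[pair pair_t Nat.ltb num];
    rewrite ?subst_pair_t, ?subst_num, ?IH1, ?IH2, ?IH3, ?IH4; auto.
  destruct (Nat.ltb_spec i d) as [Hi|Hi].
  - rewrite upn_lt by assumption. cbn -[pair num Nat.ltb].
    destruct (Nat.ltb_spec i d); [|lia]. now rewrite subst_num.
  - rewrite upn_ge by assumption. rewrite subst_num.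
    apply dot_succ_atom, f_succ_atom.
Qed.

Lemma dot_fm_subst d p : dot_fm d (subst (upn d f) p) = subst_tm f (dot_fm d p).
Proof.
  revert d; induction p; intros d; cbn -[pair pair_t num]; unfold imp_t, dot_tm;
    rewrite ?subst_pair_t, ?subst_num;
    repeat match goal with
    | |- context [dot_succs d (subst_tm _ ?t)] =>
        rewrite (proj1 (dot_tm_subst d t)), (proj2 (dot_tm_subst d t))
    end;
    rewrite ?IHp1, ?IHp2; auto.
  all: f_equal; apply (IHp (S d)).
Qed.

(** For these substitutions the two sides are the same term: successors on a variable
    add to the length of the block that stands for its numeral. If a sum is substituted
    instead, the left side codes the sum as a term and the right side codes the numeral
    of its value. *)
Lemma dot_subst p : dot (subst f p) = subst_tm f (dot p).
Proof. exact (dot_fm_subst 0 p). Qed.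

End DotSubst.

(** * The provability predicate *)

Section Provability.
Context (M : theory) (M_IDelta0 : forall p, IDelta0 p -> M ⊢ p).
Context (Box : fm) (Box_prov : provability_predicate M Box).

Let Box_bounded : bounded 1 Box := box_bounded _ _ Box_prov.

Lemma Box_mp G s t :
  entails M G (inst Box (imp_t s t)) -> entails M G (inst Box s) ->
  entails M G (inst Box t).
Proof.
  intros Hst Hs.
  pose proof (proves_subst M G (scons s (scons t Var)) _ (GD2 _ _ Box_prov)) as H.
  cbn -[imp_t] in H; rewrite !subst_inst in H by exact Box_bounded.
  exact (ImpE _ _ _ _ (ImpE _ _ _ _ H Hst) Hs).
Qed.

(** The rule that moves an argument inside the box; it uses that [dot] takes an
    implication to [imp_t] of the dotted parts by computation. *)
Lemma Box_mono G p q :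
  bounded 1 (Imp p q) -> M ⊢ Imp p q ->
  entails M G (inst Box (dot p)) -> entails M G (inst Box (dot q)).
Proof.
  intros Hb H; apply Box_mp, entails_of_proves, (GD1 _ _ Box_prov _ Hb H).
Qed.

(** For a sentence [p] the closed term [dot p] is in general built with sums and
    products, whereas [quote p] is a numeral; arithmetic computes the one to the other. *)
Lemma Box_dot_quote G p :
  bounded 0 p -> entails M G (Iff (inst Box (dot p)) (inst Box (quote p))).
Proof.
  intros Hp.
  assert (Heq : forall G, entails M G (Eq (dot p) (quote p))).
  { intros G'.
    pose proof (closed_term_value M M_IDelta0 G' (fun _ => 0) (dot p)
      (bounded_dot 0 p Hp)) as H.
    rewrite eval_dot, (subst_bounded_id 0) in H by (assumption || lia).
    exact H. }
  apply AndI; apply ImpI.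
  - apply EqSub with (dot p); [apply Heq|apply Hyp; now left].
  - apply EqSub with (quote p); [apply Eq_sym, Heq|apply Hyp; now left].
Qed.

(** * The fixed point *)

Context (Y : fm) (Y_free : bounded 1 Y).
Context (Y_fix : M ⊢ Iff Y (All (Imp (Lt (Var 1) (Var 0)) (Neg (inst Box (dot Y)))))).

(** [Box_Y t] says that Y(n) is provable for the value n of [t]; in general
    this differs from the box of the quoted formula [inst Y t]. *)
Definition Box_Y (t : tm) : fm := inst Box (subst_tm (scons t Var) (dot Y)).

Definition Y_body : fm := Imp (Lt (Var 1) (Var 0)) (Neg (inst Box (dot Y))).

Lemma Y_unfold G s : entails M G (Iff (inst Y s) (subst (scons s Var) (All Y_body))).
Proof. exact (proves_subst M G (scons s Var) _ Y_fix). Qed.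

Lemma Y_elim G s t :
  entails M G (inst Y s) -> entails M G (Lt s t) -> entails M G (Neg (Box_Y t)).
Proof.
  intros Hs Hst.
  pose proof (AllE_subst _ _ _ _ t (ImpE _ _ _ _ (AndE1 _ _ _ _ (Y_unfold G s)) Hs)) as Ht.
  apply (ImpE _ _ (Lt s t)); [|exact Hst].
  change (entails M G (Imp (Lt s t)
    (Neg (subst (scons t (scons s Var)) (inst Box (dot Y)))))) in Ht.
  rewrite subst_inst in Ht by exact Box_bounded. unfold Box_Y.
  erewrite subst_tm_ext_bounded; [exact Ht|exact (bounded_dot 1 Y Y_free)|].
  intros [|i] Hi; [reflexivity|lia].
Qed.

Lemma Y_intro G s :
  entails M (Lt (shift_tm s) (Var 0) :: map shift G) (Neg (inst Box (dot Y))) ->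
  entails M G (inst Y s).
Proof.
  intros H. refine (ImpE _ _ _ _ (AndE2 _ _ _ _ (Y_unfold G s)) _).
  apply AllI, ImpI.
  change (entails M (Lt (shift_tm s) (Var 0) :: map shift G)
    (subst (up (scons s Var)) (Neg (inst Box (dot Y))))).
  rewrite (subst_bounded_id 1); [exact H| |].
  - split; [|exact I].
    apply bounded_inst; [exact Box_bounded|exact (bounded_dot 1 Y Y_free)].
  - intros [|i] Hi; [reflexivity|lia].
Qed.

Lemma Box_Y_Var0 : Box_Y (Var 0) = inst Box (dot Y).
Proof.
  unfold Box_Y; f_equal. rewrite <- (subst_tm_id (dot Y)) at 2.
  apply (subst_tm_ext_bounded 1); [exact (bounded_dot 1 Y Y_free)|].
  intros [|i] Hi; [reflexivity|lia].
Qed.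

(** This is where [dot_subst] is needed: it lets provability of the formula Y(x+1),
    quoted as a whole, be read as provability of Y at the number x+1. *)
Lemma Box_dot_Y_Succ : inst Box (dot (inst Y (Succ (Var 0)))) = Box_Y (Succ (Var 0)).
Proof. unfold Box_Y, inst at 2; f_equal. apply dot_subst; intros [|i]; exact I. Qed.

(** The sentences Y(k) weaken as k grows, because fewer x lie above a larger k. *)
Lemma Y_Succ : M ⊢ Imp Y (inst Y (Succ (Var 0))).
Proof.
  apply ImpI, Y_intro. cbn. rewrite <- Box_Y_Var0. apply Y_elim with (Var 1).
  - rewrite <- (inst_Var0 Y Y_free) at 1; rewrite shift_inst by exact Y_free.
    apply Hyp; right; now left.
  - apply (Lt_of_Succ_Lt M M_IDelta0), Hyp; now left.
Qed.

(** One instance of the universal claim in Y(x) already matters: x+1 lies above x. *)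
Lemma Y_Succ_not_Box : M ⊢ Imp Y (Neg (Box_Y (Succ (Var 0)))).
Proof.
  apply ImpI, Y_elim with (Var 0).
  - rewrite (inst_Var0 Y Y_free). apply Hyp; now left.
  - apply (Lt_Succ M M_IDelta0).
Qed.

Definition zero_eq_one : fm := Eq (num 0) (num 1).

(** If some Y(x) is provable, then on the one hand Y(x+1) is provable, by [Y_Succ]
    inside the box, and [GD3] makes this fact provable as well; on the other hand
    [Y_Succ_not_Box] inside the box makes its negation provable. *)
Lemma Box_Y_inconsistent G :
  entails M G (inst Box (dot Y)) -> entails M G (inst Box (quote zero_eq_one)).
Proof.
  intros HY. set (B := Box_Y (Succ (Var 0))).
  assert (B_bounded : bounded 1 B).
  { apply bounded_inst; [exact Box_bounded|].
    apply (bounded_subst_tm _ 1); [exact (bounded_dot 1 Y Y_free)|].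
    intros [|i] Hi; cbn; lia. }
  assert (HB : entails M G B).
  { unfold B; rewrite <- Box_dot_Y_Succ. apply Box_mono with Y; auto using Y_Succ.
    split; [exact Y_free|]. apply bounded_inst; [exact Y_free|cbn; lia]. }
  assert (HBB : entails M G (inst Box (dot B))).
  { eapply Imp_mp; [|exact HB].
    apply (GD3 _ _ Box_prov), Sigma1_subst, (box_Sigma1 _ _ Box_prov). }
  assert (HBC : entails M G (inst Box (dot (Imp B zero_eq_one)))).
  { apply Box_mono with Y; [cbn; auto| |exact HY].
    apply ImpI, ImpI, Raa.
    apply ImpE with B; [|apply Hyp; right; now left].
    eapply Imp_mp; [exact Y_Succ_not_Box|apply Hyp; right; right; now left]. }
  eapply ImpE; [eapply AndE1, Box_dot_quote; cbn; auto|].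
  exact (Box_mp _ _ _ HBC HBB).
Qed.

Lemma shift_Con : shift (Con Box) = Con Box.
Proof.
  apply (subst_bounded_id 0); [|lia].
  split; [|exact I]. apply bounded_inst; [exact Box_bounded|apply bounded_num].
Qed.

(** The x > k of the fixed point is arbitrary, and each Box Y(x) alone already
    refutes consistency, so consistency yields all of its instances. *)
Lemma Con_Y : M ⊢ Imp (Con Box) Y.
Proof.
  apply ImpI. rewrite <- (inst_Var0 Y Y_free) at 1. apply Y_intro, ImpI. cbn [map].
  apply ImpE with (inst Box (quote zero_eq_one)).
  - rewrite shift_Con; apply Hyp; right; right; now left.
  - apply Box_Y_inconsistent, Hyp; now left.
Qed.

(** An inconsistent theory proves Y(k+1), which Y(k) forbids. *)
Lemma Y_Con : M ⊢ Imp Y (Con Box).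
Proof.
  apply ImpI, ImpI. apply ImpE with (Box_Y (Succ (Var 0))).
  - eapply Imp_mp; [exact Y_Succ_not_Box|apply Hyp; right; now left].
  - rewrite <- Box_dot_Y_Succ. apply Box_mono with zero_eq_one.
    + split; [cbn; auto|]. apply bounded_inst; [exact Y_free|cbn; lia].
    + apply ImpI, Raa. eapply ImpE; [apply (zero_ne_one M M_IDelta0)|].
      apply Hyp; right; now left.
    + eapply ImpE; [eapply AndE2, Box_dot_quote; cbn; auto|]. apply Hyp; now left.
Qed.

End Provability.

(* Variable 0 of [Y] is k. Under the quantifier, variable 0 is x and variable 1 is k;
   as [Y] has no free variable but 0, [dot Y] is there the dotted quotation of Y at x. *)
Theorem theorem6 (M : theory) (Box Y : fm)
  (M_re : recursively_enumerable (theorem_number M))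
  (M_power : extends_elementary_arithmetic M)
  (Box_prov : provability_predicate M Box)
  (Y_free : bounded 1 Y)
  (Y_fix : M ⊢ Iff Y (All (Imp (Lt (Var 1) (Var 0)) (Neg (inst Box (dot Y)))))) :
  M ⊢ Iff (Con Box) Y.
Proof.
  destruct M_power as [E [_ M_exp]].
  assert (M_IDelta0 : forall p, IDelta0 p -> M ⊢ p).
  { intros p Hp; apply M_exp; now constructor. }
  apply AndI; [apply (Con_Y M M_IDelta0)|apply (Y_Con M M_IDelta0)]; assumption.
Qed.
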